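(* Let $G$ be a finite simple graph. The gyrochromatic number $\chi_g(G)$ is equal to \[\inf_{\substack{Z,\ S\subseteq Z \\ G\to C(Z,S)}}\chi_f\left(C(Z,S)\right)=\inf_{\substack{Z,\ S\subseteq Z \\ G\to C(Z,S)}}\frac{|Z|}{\alpha\left(C(Z,S)\right)},\] where the infima are taken over all finite abelian groups $Z$ and all $S\subseteq Z$ with $S=-S$ and $0\notin S$ such that $G$ is homomorphic to the Cayley graph $C(Z,S)$.
   Context: Let $\mathbb{T}=\mathbb{R}/\mathbb{Z}$ with Haar (Lebesgue) probability measure $\mu$. A set $A\subseteq \mathbb{T}$ is a coloring $\mathbb{T}$-base for $G$ if there exists a function $f:V(G)\to \mathbb{T}$ such that $A+f(u)$ and $A+f(v)$ are disjoint for every edge $uv$ of $G$. Let $\sigma_{\mathbb{T}}(G)=\sup\{\mu(A): A \text{ is a Borel coloring } \mathbb{T}\text{-base for } G\}$ and $\chi_g(G)=1/\sigma_{\mathbb{T}}(G)$ (the gyrochromatic number). For an abelian group $Z$ and $S\subseteq Z$ with $S=-S$ and $0\notin S$, the Cayley graph $C(Z,S)$ has vertex set $Z$, with $x$ and $y$ adjacent iff $y-x\in S$. $G\to H$ means there is a graph homomorphism from $G$ to $H$, i.e. a map $V(G)\to V(H)$ sending edges to edges. $\alpha$ is the independence number. The fractional chromatic number $\chi_f(H)$ is the smallest real $z$ for which there is an assignment of non-negative weights to the independent sets of $H$ with total weight $z$ such that for each vertex the total weight of independent sets containing it is at least one. *)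

(* Defs.v *)
From HB Require Import structures.
From mathcomp Require Import all_boot all_order all_algebra.
From mathcomp Require Import all_classical all_reals all_analysis.

Set Implicit Arguments.
Unset Strict Implicit.
Unset Printing Implicit Defensive.

Import Order.TTheory GRing.Theory Num.Theory.
Import numFieldNormedType.Exports.

Local Open Scope classical_set_scope.
Local Open Scope ring_scope.

(* A finite simple graph is a symmetric irreflexive relation on a finType. *)

Definition graph_hom (V W : finType) (e : rel V) (e' : rel W) : Prop :=
  exists h : V -> W, forall u v, e u v -> e' (h u) (h v).

Definition independent (V : finType) (e : rel V) (I : {set V}) : bool :=
  [forall x in I, forall y in I, ~~ e x y].

Definition independence_number (V : finType) (e : rel V) : nat :=
  \max_(I : {set V} | independent e I) #|I|.

Section FractionalChromaticNumber.
Variables (R : realType) (V : finType) (e : rel V).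

Definition fractional_coloring (w : {set V} -> R) (z : R) : Prop :=
  [/\ forall I, independent e I -> 0 <= w I,
      \sum_(I : {set V} | independent e I) w I = z
    & forall v, 1 <= \sum_(I : {set V} | independent e I && (v \in I)) w I].

(* The least total weight.  It exists, as the optimum of a feasible linear
   program bounded below, so the default value 0 of xget is never used. *)
Definition fractional_chromatic_number : R :=
  let totals := [set z | exists w, fractional_coloring w z] in
  xget 0 [set z | totals z /\ lbound totals z].

End FractionalChromaticNumber.

Definition cayley (Z : finZmodType) (S : {set Z}) : rel Z :=
  fun x y => y - x \in S.

Definition connection_set (Z : finZmodType) (S : {set Z}) : Prop :=
  S = [set - s | s in S]%SET /\ 0 \notin S.

Section Circle.
Variable R : realType.

(* The quotient group R/Z: Num.int_num_subdef is the predicate behind Num.int,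
   the one that carries the structure of an additive subgroup. *)
Definition circle : zmodType := @Quotient.quot R (Num.int_num_subdef : {pred R}).

Definition circle_borel (A : set circle) : Prop :=
  <<s [set U : set (quotient_topology circle) | open U] >> A.

(* The Haar probability measure: Lebesgue measure carried by a fundamental
   domain. *)
Definition circle_haar (A : set circle) : \bar R :=
  lebesgue_measure (`[0, 1[ `&` (\pi_circle)%qT @^-1` A).

Definition translate (A : set circle) (t : circle) : set circle :=
  [set a + t | a in A].

End Circle.

Section Gyrochromatic.
Variables (R : realType) (V : finType) (e : rel V).

Definition coloring_base (A : set (circle R)) : Prop :=
  exists f : V -> circle R, forall u v : V, e u v ->
    translate A (f u) `&` translate A (f v) = set0.

Definition gyro_density : \bar R :=
  ereal_sup [set circle_haar A | A in
    [set A | circle_borel A /\ coloring_base A]].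

Definition gyrochromatic_number : \bar R := (gyro_density^-1)%E.

End Gyrochromatic.

(* Main.v *)
Require Import Defs.
From HB Require Import structures.
From mathcomp Require Import all_boot all_order all_algebra.
From mathcomp Require Import all_classical all_reals all_analysis.
From mathcomp Require Import measurable_realfun zify ring lra.
Import Order.TTheory GRing.Theory Num.Theory.
Import numFieldNormedType.Exports.
Local Open Scope classical_set_scope.
Local Open Scope ring_scope.

(* A Cayley graph on Z has fractional chromatic number |Z| / alpha, by double
   counting and by spreading weight evenly over the translates of a largest
   independent set.  It remains to compare the ratios alpha / |Z| with the
   measures of coloring bases, up to a factor ((M + 1) / (M + 2)) ^ #|V| tending
   to 1.

   Let h be a homomorphism from G to a Cayley graph on Z.  On the box of digit
   vectors d : V -> [0, M], the map F d = \sum_v d_v h v satisfies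
   F (d + 1_v) = F d + h v.  Reading d in base M + 2 embeds the box in the cyclic
   group of order N = (M + 2) ^ #|V|, and adding 1_v produces no carry.  The arcs
   of length 1/N placed at the vectors d for which F d lies in an independent set
   thus form a coloring base, with f v = (M + 2) ^ (index of v) / N.

   Conversely, let A be a coloring base for f, and average over x in the circle
   the number of vectors d of the box with x + \sum_v d_v f v in A: for each x
   these d form an independent set of the Cayley graph on (Z/(M + 2))^V whose
   connection set consists of the differences 1_v - 1_u along the edges. *)

(** * Independent sets and fractional chromatic numbers of Cayley graphs *)

Lemma independentP (V : finType) (e : rel V) (I : {set V}) :
  reflect {in I &, forall x y, ~~ e x y} (independent e I).
Proof.
apply: (iffP forall_inP) => [H x y xI yI|H x xI]; first exact: (forall_inP (H x xI)).
by apply/forall_inP => y yI; exact: H.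
Qed.

Lemma leq_independence_number (V : finType) (e : rel V) (I : {set V}) :
  independent e I -> (#|I| <= independence_number e)%N.
Proof.
by move=> iI; exact: (@leq_bigmax_cond _ (independent e) (fun I : {set V} => #|I|)).
Qed.

Section Cayley.
Context {Z : finZmodType} {S : {set Z}}.
Hypothesis S0 : 0 \notin S.

Lemma independent_translate (I : {set Z}) (t : Z) :
  independent (cayley S) I -> independent (cayley S) [set x + t | x in I]%SET.
Proof.
move=> /independentP iI; apply/independentP => _ _ /imsetP[x xI ->] /imsetP[y yI ->].
by rewrite /cayley opprD addrACA subrr addr0; exact: iI.
Qed.

Lemma independence_number_gt0 : (0 < independence_number (cayley S))%N.
Proof.
apply: (@leq_trans #|[set (0 : Z)]%SET|); first by rewrite cards1.
apply: leq_independence_number; apply/independentP => x y.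
by rewrite !inE => /eqP -> /eqP ->; rewrite /cayley subrr.
Qed.

Lemma independence_number_attained :
  exists2 I : {set Z}, independent (cayley S) I
    & #|I| = independence_number (cayley S).
Proof.
have [|I iI eI] := @eq_bigmax_cond _ (independent (cayley S)) (fun I => #|I|).
  by apply/card_gt0P; exists finset.set0; apply/independentP => x y; rewrite inE.
by exists I.
Qed.

(** The translate of [I] by [t] contains [z] exactly when [t = z - x] for some [x] in [I], and
    [x |-> z - x] is injective. *)
Lemma card_translates_mem (I : {set Z}) (z : Z) :
  #|[set t | z \in [set x + t | x in I]%SET]%SET| = #|I|.
Proof.
rewrite -(card_imset I (can_inj (subKr z))); apply: eq_card => x; rewrite inE.
apply/imsetP/imsetP => -[y yI E]; exists y => //.
  by rewrite E addrC addKr.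
by rewrite E addrC subrK.
Qed.

Lemma fractional_chromatic_cayley (R : realType) :
  fractional_chromatic_number R (cayley S) =
  #|Z|%:R / (independence_number (cayley S))%:R.
Proof.
set a := independence_number _.
have a0 : 0 < a%:R :> R by rewrite ltr0n independence_number_gt0.
rewrite /fractional_chromatic_number.
pose totals : set R := [set z | exists w, fractional_coloring (cayley S) w z].
rewrite -/totals; set m : R := _ / _.
(* Sum the covering condition over all vertices: each independent set [I] is counted [#|I| <= a]
   times. *)
have lbm : lbound totals m.
  move=> z [w []] w0 <- w1; rewrite ler_pdivrMr//.
  rewrite -sum1_card natr_sum.
  apply: (le_trans (ler_sum _ (fun v _ => w1 v))).
  rewrite (exchange_big_dep (independent (cayley S)))/=; last by move=> ? ? _ /andP[].
  rewrite mulr_suml; apply: ler_sum => I iI.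
  rewrite (eq_bigl (mem I)); last by move=> v; rewrite iI.
  rewrite sumr_const -[leLHS]mulr_natr; apply: ler_wpM2l; first exact: w0.
  by rewrite ler_nat; exact: leq_independence_number.
have [I0 iI0 cI0] := independence_number_attained.
have tm : totals m.
  pose T t := [set x + t | x in I0]%SET.
  have iT t : independent (cayley S) (T t) by exact: independent_translate.
  (* Each [t] gives weight [1/a] to its translate; the sum is needed because different [t] may give
     the same set. *)
  exists (fun I => \sum_(t | T t == I) a%:R^-1); split.
  - by move=> I _; apply: sumr_ge0 => ? _; rewrite invr_ge0 ltW.
  - rewrite -(partition_big T (independent (cayley S)) (P := xpredT))//=.
    by rewrite sumr_const -[LHS]mulr_natl.
  - move=> v; rewrite (eq_bigr (fun I : {set Z} =>
        \sum_(t | (v \in T t) && (T t == I)) (a%:R^-1 : R))).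
      rewrite -(partition_big T (fun I => independent (cayley S) I && (v \in I))
                  (P := fun t => v \in T t))/=; last by move=> t ->; rewrite iT.
      rewrite sumr_const -cardsE card_translates_mem cI0 -[leRHS]mulr_natl.
      by rewrite divff ?gt_eqF.
    move=> I /andP[_ vI]; apply: eq_bigl => t.
    by case: eqP => [->|_]; rewrite ?vI ?andbF.
case: xgetP => [y _ [ty lby]|/(_ m) []]; last by split.
by apply/le_anti/andP; split; [exact: lby | exact: lbm].
Qed.

(* Averaging over the translates of a largest independent set. *)
Lemma independent_preimage (X : finType) (F : X -> Z) :
  exists2 I : {set Z}, independent (cayley S) I &
    (independence_number (cayley S) * #|X| <= #|[set x | F x \in I]%SET| * #|Z|)%N.
Proof.
have [I0 iI0 cI0] := independence_number_attained.
pose T t := [set x + t | x in I0]%SET.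
pose c t := #|[set x | F x \in T t]%SET|.
have sumc : (\sum_t c t = independence_number (cayley S) * #|X|)%N.
  rewrite -cI0 mulnC -sum_nat_const.
  under eq_bigr => t _ do rewrite /c -sum1dep_card big_mkcond.
  rewrite exchange_big; apply: eq_bigr => x _.
  by rewrite -big_mkcond sum1dep_card card_translates_mem.
have [t _ ct] := @arg_maxnP Z 0 xpredT c isT.
exists (T t); first exact: independent_translate.
by rewrite -sumc [leqRHS]mulnC -sum_nat_const leq_sum// => s _; exact: ct.
Qed.

End Cayley.

(** * Positional numeration and the limit over growing boxes *)

(** The weights are the powers of [M] along an enumeration of [V], so the sums are numerals in base
    [M] with [#|V|] digits. *)
Lemma positional_weights (V : finType) (M : nat) :
  exists p : V -> nat,
    (forall d : V -> nat, (forall v, d v < M)%N ->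
      (\sum_v d v * p v < M ^ #|V|)%N) /\
    (forall d d' : V -> nat, (forall v, d v < M)%N -> (forall v, d' v < M)%N ->
      (\sum_v d v * p v = \sum_v d' v * p v)%N -> d =1 d').
Proof.
pose E k (d : nat -> nat) := (\sum_(i < k) d i * M ^ i)%N.
have ES k d : E k.+1 d = (d 0 + E k (d \o succn) * M)%N.
  rewrite /E big_ord_recl expn0 muln1 big_distrl/=; congr addn.
  by apply: eq_bigr => i _; rewrite /bump/= expnSr mulnA.
have Elt k : forall d, (forall i, d i < M)%N -> (E k d < M ^ k)%N.
  elim: k => [|k IH] d dM; first by rewrite /E big_ord0.
  rewrite ES expnSr; have M0 : (0 < M)%N := leq_ltn_trans (leq0n _) (dM 0).
  apply: (@leq_trans ((E k (d \o succn)).+1 * M)); first by rewrite mulSn ltn_add2r.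
  by rewrite leq_mul2r IH ?orbT// => i; exact: dM.
have Einj k : forall d d', (forall i, d i < M)%N -> (forall i, d' i < M)%N ->
    E k d = E k d' -> forall i, (i < k)%N -> d i = d' i.
  elim: k => [|k IH] d d' dM dM'; first by [].
  have M0 : (0 < M)%N := leq_ltn_trans (leq0n _) (dM 0).
  rewrite !ES => H [_|i ik].
    by have := congr1 (modn^~ M) H; rewrite ![(_ + _ * M)%N]addnC !modnMDl !modn_small.
  apply: (IH (d \o succn) (d' \o succn)) => // [?|?|]; do ?exact: dM; do ?exact: dM'.
  have := congr1 (divn^~ M) H.
  by rewrite ![(_ + _ * M)%N]addnC !divnMDl// !divn_small// !addn0.
have tr (d : V -> nat) : (\sum_v d v * M ^ enum_rank v)%N =
    E #|V| (fun i => oapp (fun j : 'I_#|V| => d (enum_val j)) 0 (insub i))%N.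
  rewrite (reindex (@enum_val V V))/=; last first.
    by exists enum_rank => x _; rewrite ?enum_valK ?enum_rankK.
  by apply: eq_bigr => i _; rewrite enum_valK valK.
(* The padding digit 0 is below [M] because some [d v] is; for empty [V], [M] could be 0. *)
have lt (d : V -> nat) : (forall v, d v < M)%N -> (0 < #|V|)%N -> forall i,
    (oapp (fun j : 'I_#|V| => d (enum_val j)) 0 (insub i) < M)%N.
  move=> dM /card_gt0P[v _] i; case: insubP => [j _ _|_] /=; first exact: dM.
  exact: leq_ltn_trans (dM v).
exists (fun v => M ^ enum_rank v)%N; split.
  move=> d dM; rewrite tr; have [V0|V0] := posnP #|V|; last by apply: Elt; exact: lt.
  rewrite /E big1 ?expn_gt0 ?V0 ?orbT// => i _.
  by have := ltn_ord i; rewrite [X in (_ < X)%N]V0.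
move=> d d' dM dM' + v.
have V0 : (0 < #|V|)%N by apply/card_gt0P; exists v.
rewrite !tr => /Einj H; have := H (lt _ dM V0) (lt _ dM' V0) (enum_rank v) (ltn_ord _).
by rewrite valK /= enum_rankK.
Qed.

(** Bernoulli's inequality bounds [(M.+1 / M.+2) ^ k] below by [1 - k / M.+2], which tends to 1. *)
Lemma box_ratio_limit (R : realType) (k : nat) (x y : R) : 0 <= x ->
  (forall M, x * M.+1%:R ^+ k <= y * M.+2%:R ^+ k) -> x <= y.
Proof.
move=> x0 H; apply/ler_addgt0Pr => eps eps0.
have bernoulli (t : R) : 0 <= t <= 1 -> 1 - k%:R * t <= (1 - t) ^+ k.
  move=> /andP[t0 t1]; elim: k {H} => [|k IH]; first by rewrite mul0r subr0.
  rewrite exprSr; apply: le_trans (ler_wpM2r _ IH); last by rewrite subr_ge0.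
  have : 0 <= k%:R * t * t by rewrite !mulr_ge0.
  by rewrite -natr1; nra.
(* This choice makes the loss [x * k / M.+2] smaller than [eps]. *)
pose M := Num.truncn (x * k%:R / eps).
have MM : x * k%:R / eps < M.+1%:R by rewrite truncnS_gt.
have M2 : 0 < M.+2%:R :> R by [].
rewrite -lerBlDr.
have := H M; rewrite -ler_pdivrMr ?exprn_gt0// -mulrA -exprVn -exprMn => {}H.
apply: le_trans H.
have -> : M.+1%:R / M.+2%:R = 1 - M.+2%:R^-1 :> R.
  have M2_neq0 := lt0r_neq0 M2; apply: (mulIf M2_neq0).
  by rewrite mulrBl !divfK// mul1r mulVf// -[M.+2%:R]natr1 addrK.
have tt : 0 <= (M.+2%:R^-1 : R) <= 1 by rewrite invr_ge0 ler0n invf_le1// ler1n.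
apply: le_trans (ler_wpM2l x0 (bernoulli _ tt)).
rewrite mulrBr mulr1 lerD2l lerN2 mulrA ler_pdivrMr//.
rewrite -ler_pdivrMl// [leLHS]mulrC; apply: ltW; apply: lt_trans MM _.
by rewrite ltr_nat.
Qed.

(** * Measure on the circle, computed on lifts to the line *)

Section Circle.
Context {R : realType}.
Local Notation pi := (\pi_(circle R)%qT : R -> circle R).
Local Notation mu := (@lebesgue_measure R).

Lemma circle_piD (x y : R) : pi (x + y) = pi x + pi y.
Proof. exact: raddfD. Qed.

Lemma circle_piP (x y : R) : reflect (exists n : int, x = y + n%:~R) (pi x == pi y).
Proof.
rewrite -Quotient.idealrBE; apply: (iffP (@Num.int_num_subproof _ _)) => -[n E]; exists n.
  by rewrite -E addrC subrK.
by rewrite E addrAC subrr add0r.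
Qed.

Lemma circle_pi_surj (a : circle R) : exists x : R, pi x = a.
Proof. by exists (repr a); rewrite reprK. Qed.

(** The pushforward under a translation agrees with Lebesgue measure on half-open intervals, so
    uniqueness applies. *)
Lemma lebesgue_measure_shift (t : R) (A : set R) : measurable A ->
  mu ((fun x => x + t) @^-1` A) = mu A.
Proof.
move=> mA.
have mt : measurable_fun [set: R] (fun x : R => x + t : measurableTypeR R).
  by apply: measurable_funD => //; exact: measurable_cst.
rewrite -[LHS]/(pushforward mu (fun x : R => x + t : measurableTypeR R) A).
apply/esym/lebesgue_measure_unique => //=; rewrite /pushforward.
move=> _ [[a b] _ <-] /=.
have -> : (fun x => x + t) @^-1` `]a, b] = `]a - t, b - t]%classic.
  by apply/seteqP; split => x /=; rewrite !in_itv/= ltrBlDr lerBrDr.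
by rewrite !lebesgue_measure_itv/= !lte_fin ltrD2r -!EFinB opprB addrA subrK.
Qed.

(** The sets with measurable preimage form a sigma-algebra that contains the open sets. *)
Lemma circle_borel_measurable (A : set (circle R)) :
  circle_borel A -> measurable (pi @^-1` A).
Proof.
pose C := image_set_system [set: R] pi measurable.
suff : <<s [set U : set (quotient_topology (circle R)) | open U] >> `<=` C.
  by move=> H /H; rewrite /C/image_set_system/= setTI.
apply: smallest_sub.
  exact/sigma_algebra_image/sigma_algebra_measurable.
by move=> U oU; rewrite /C/image_set_system/= setTI; exact: open_measurable.
Qed.

Lemma circle_borel_image_open (U : set R) : open U -> circle_borel (pi @` U).
Proof.
move=> oU; apply: sub_sigma_algebra => /=.
rewrite /open/= /quotient_open.
(* The preimage of the image is the union of the integer translates of [U], hence open. *)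
have -> : pi @^-1` (pi @` U) = \bigcup_(n : int) ((fun x => x - n%:~R) @^-1` U).
  apply/seteqP; split => x /=.
    move=> [y Uy /eqP/circle_piP[n E]]; exists (- n) => //=.
    by rewrite -[_%:~R]/(_ *~ _) mulrNz opprK -E.
  move=> [n _ /= Ux]; exists (x - n%:~R) => //.
  by apply/eqP/circle_piP; exists (- n); rewrite mulrNz.
apply: bigcup_open => n _; apply: open_comp => // x _.
by apply: cvgB; [exact: cvg_id | exact: cvg_cst].
Qed.


Definition periodic (P : set R) := forall x (n : int), P (x + n%:~R) <-> P x.

(** This is the translation invariance of [circle_haar], read on lifts. After reducing to
    [0 <= t < 1], the window [[t, 1 + t[] is cut at 1 and its second piece is moved back to [[0, t[]
    by periodicity. *)
Lemma lebesgue_measure_periodic (P : set R) (t : R) : measurable P -> periodic P ->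
  mu (`[0, 1[ `&` (fun x => x + t) @^-1` P) = mu (`[0, 1[ `&` P).
Proof.
move=> mP pP.
wlog t01 : t / 0 <= t < 1.
  move=> H; rewrite -(H (t - (Num.floor t)%:~R)).
    congr (mu (_ `&` _)); apply/seteqP; split => x /=; rewrite addrA.
      by move=> Px; apply/(pP _ (Num.floor t)); rewrite subrK.
    by move=> /(pP _ (Num.floor t)); rewrite subrK.
  have /andP[h1 h2] := floor_itv t.
  by rewrite subr_ge0 h1 ltrBlDl; move: h2; rewrite intrD.
have /andP[t0 t1] := t01.
have mI a b : measurable (`[a, b[ `&` P) by apply: measurableI.
have split a b c : a <= b <= c ->
    (mu (`[a, c[ `&` P) = mu (`[a, b[ `&` P) + mu (`[b, c[ `&` P))%E.
  move=> /andP[ab bc]; rewrite -measureU; [|exact: mI|exact: mI|].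
    rewrite -setIUl; congr (mu (_ `&` _)).
    apply/seteqP; split => x /=; rewrite !in_itv/=.
      move=> /andP[ax xc]; rewrite ax xc andbT.
      by case: (ltP x b) => xb; [left|right].
    move=> [/andP[-> xb]|/andP[bx ->]]; first by rewrite (lt_le_trans xb bc).
    by rewrite (le_trans ab bx).
  apply/seteqP; split => x //= -[[+ _] [+ _]]; rewrite !in_itv/=.
  by move=> /andP[_ xb] /andP[bx _]; have := lt_le_trans xb bx; rewrite ltxx.
have -> : `[0, 1[ `&` (fun x => x + t) @^-1` P =
    (fun x => x + t) @^-1` (`[t, 1 + t[ `&` P).
  by apply/seteqP; split => x /=; rewrite !in_itv/= lerDr ltrD2r.
rewrite lebesgue_measure_shift// (split t 1); last by rewrite ltW//= lerDl.
rewrite (split 0 t); last by rewrite t0 ltW.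
rewrite addeC; congr (_ + _)%E.
rewrite -(lebesgue_measure_shift 1)//; congr (mu _).
apply/seteqP; split => x /=; rewrite !in_itv/= lerDr [1 + t]addrC ltrD2r.
  by move=> [? /(pP _ 1)].
by move=> [? Px]; split => //; apply/(pP _ 1).
Qed.

Lemma circle_pi_int (x : R) (n : int) : pi (x + n%:~R) = pi x.
Proof. by apply/eqP/circle_piP; exists n. Qed.

Lemma circle_haar_le1 (A : set (circle R)) : circle_borel A -> (circle_haar A <= 1)%E.
Proof.
move=> /circle_borel_measurable mA.
have -> : (1 = mu `[0%R, 1%R[)%E by rewrite lebesgue_measure_itv/= lte_fin ltr01 sube0.
by apply: le_measure => //; rewrite inE//; exact: measurableI.
Qed.

Lemma circle_haar_image (U : set R) : open U -> U `<=` `[0, 1[ ->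
  (mu U <= circle_haar (pi @` U))%E.
Proof.
move=> oU U01; apply: le_measure; rewrite ?inE.
- exact: open_measurable.
- apply: measurableI => //.
  by apply: circle_borel_measurable; exact: circle_borel_image_open.
- by move=> x Ux; split; [exact: U01 | exists x].
Qed.

(** Integrate over [x] the number of [i] with [x + t i] in [A]: by invariance each [i] contributes
    [circle_haar A], and the integrand is at most [c] on a domain of measure 1. *)
Lemma circle_haar_average (I : finType) (t : I -> circle R) (A : set (circle R))
    (c : nat) : circle_borel A ->
  (forall x, (#|[set i | `[< A (x + t i)%R >]]%SET| <= c)%N) ->
  (#|I|%:R%:E * circle_haar A <= c%:R%:E)%E.
Proof.
move=> /circle_borel_measurable mA Ac.
pose s i := sval (cid (circle_pi_surj (t i))).
have sE i : pi (s i) = t i := svalP (cid (circle_pi_surj (t i))).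
pose P i := (fun x => x + s i) @^-1` (pi @^-1` A).
have mP i : measurable (P i).
  have : measurable_fun [set: R] (fun x : R => x + s i : measurableTypeR R).
    by apply: measurable_funD => //; exact: measurable_cst.
  by move=> /(_ measurableT _ mA); rewrite setTI.
have mf i : measurable_fun (`[0, 1[ : set (measurableTypeR R))
    (fun x => (\1_(P i) x)%:E : \bar R).
  by apply/measurable_EFinP; apply: measurable_indic; exact: mP.
have -> : (#|I|%:R%:E * circle_haar A =
    \int[mu]_(x in `[0%R, 1%R[) \sum_i (\1_(P i) x)%:E)%E.
  rewrite ge0_integral_sum//.
  rewrite (eq_bigr (fun=> circle_haar A)); last first.
    move=> i _; rewrite integral_indic; [|by []|exact: mP].
    rewrite setIC; apply: lebesgue_measure_periodic => //.
    by move=> x n /=; rewrite circle_pi_int.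
  by rewrite mule_natl sumr_const. 
have c1 : (c%:R%:E = \int[mu]_(x in `[0%R, 1%R[) (cst c%:R%:E x))%E.
  by rewrite integral_cst//= lebesgue_measure_itv/= lte_fin ltr01 sube0 mule1.
rewrite c1; apply: ge0_le_integral => //.
- by move=> x _; apply: sume_ge0 => i _; rewrite lee_fin.
- exact: emeasurable_sum.
- move=> x _; rewrite sumEFin lee_fin.
  rewrite (eq_bigr (fun i => (`[< A (pi x + t i) >] : nat)%:R)); last first.
    by move=> i _; rewrite indicE /P; congr (_%:R); rewrite -sE -circle_piD /in_mem/=.
  rewrite -natr_sum ler_nat; apply: leq_trans (Ac (pi x)).
  by rewrite -sum1dep_card [leqRHS]big_mkcond; apply: leq_sum => i _; case: (asbool _).
Qed.

Lemma lebesgue_measure_arcs (X : finType) (J : {set X}) (c : X -> nat) (N : nat) :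
  (0 < N)%N -> {in J &, injective c} ->
  mu (\bigcup_(d in [set` J]) `](c d)%:R / N%:R, (c d).+1%:R / N%:R[%classic) =
  (#|J|%:R / N%:R)%:E.
Proof.
move=> N0 cinj; have N0' : 0 < N%:R :> R by rewrite ltr0n.
have <- : [set` enum J] = [set` J] by apply/seteqP; split => x /=; rewrite mem_enum.
rewrite measure_fin_bigcup//.
- rewrite -fsbig_seq ?enum_uniq// big_enum/=.
  rewrite (eq_bigr (fun=> (N%:R^-1)%:E)).
    by rewrite sumEFin sumr_const -[_^-1 *+ _]mulr_natl.
  move=> d _; rewrite lebesgue_measure_itv/= lte_fin ltr_pM2r ?invr_gt0// ltr_nat ltnSn.
  by rewrite -EFinB -mulrBl -natr1 addrAC subrr add0r mul1r.
(* A common point of two arcs forces [c d < c d' + 1] and [c d' < c d + 1], so the indices agree. *)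
- apply/trivIsetP => d d' /=; rewrite !mem_enum => dJ dJ' dd'.
  apply/seteqP; split => x //= -[]; rewrite !in_itv/=.
  rewrite !ltr_pdivrMr// !ltr_pdivlMr// => /andP[h1 h2] /andP[h3 h4].
  have := lt_trans h1 h4; have := lt_trans h3 h2; rewrite !ltr_nat !ltnS => h5 h6.
  by move/eqP: dd'; apply; apply: cinj => //; apply/eqP; rewrite eqn_leq h5 h6.
Qed.

End Circle.

(* Makes [{ffun V -> 'I_n.+1}] a [finZmodType]. *)
HB.saturate finfun_of.

(** Incrementing one digit adds one generator; this is used both in the group of a Cayley graph and
    in the circle. *)
Lemma sum_mulrn_incr (W : zmodType) (V : finType) (a : V -> W) (d : V -> nat) (u : V) :
  \sum_v a v *+ (d v + (v == u)) = \sum_v a v *+ d v + a u.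
Proof.
under eq_bigr do rewrite mulrnDr.
rewrite big_split/=; congr +%R.
by rewrite (bigD1 u)//= eqxx mulr1n big1 ?addr0// => v /negPf ->.
Qed.

(** * From Cayley graphs to coloring bases and back *)

Section Gyro.
Context {R : realType} {V : finType} {e : rel V}.
Local Notation pi := (\pi_(circle R)%qT : R -> circle R).
Local Notation k := #|V|.

Lemma arcs_base {Z : finZmodType} {S : {set Z}} (M : nat) :
  0 \notin S -> graph_hom e (cayley S) ->
  exists2 A : set (circle R), circle_borel A /\ coloring_base e A &
    (((independence_number (cayley S) * M.+1 ^ k)%:R / (#|Z| * M.+2 ^ k)%:R)%:E
      <= circle_haar A)%E.
Proof.
move=> S0 [h hP].
have [p [p_lt p_inj]] := positional_weights V M.+2.
pose N := (M.+2 ^ k)%N.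
have N0 : (0 < N)%N by rewrite expn_gt0.
have N0' : 0 < N%:R :> R by rewrite ltr0n.
pose enc (d : {ffun V -> 'I_M.+1}) := (\sum_v d v * p v)%N.
pose F (d : {ffun V -> 'I_M.+1}) := \sum_v h v *+ d v.
have [I iI cI] := independent_preimage (S := S) _ F.
pose J := [set d | F d \in I]%SET.
(* Box digits are at most [M], so base [M.+2] leaves room for one increment. *)
have digit (d : {ffun V -> 'I_M.+1}) u v : (d v + (v == u) < M.+2)%N.
  by have := ltn_ord (d v); case: (v == u); lia.
have encD d u : (enc d + p u = \sum_v (d v + (v == u)) * p v)%N.
  under [RHS]eq_bigr do rewrite mulnDl.
  rewrite big_split/= -/(enc d); congr addn.
  rewrite (bigD1 u)//= eqxx mul1n big1 ?addn0// => v /negPf ->.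
  by rewrite mul0n.
have encDlt d u : (enc d + p u < N)%N by rewrite encD; apply: p_lt => v; exact: digit.
have enc_lt d : (enc d < N)%N by apply: p_lt => v; exact: leqW.
have enc_inj : injective enc.
  move=> d d' E; apply/ffunP => v; apply/val_inj.
  by apply: (p_inj (fun v => d v) (fun v => d' v)) => [w|w|]; [exact: leqW..|].
pose arc d := `](enc d)%:R / N%:R, (enc d).+1%:R / N%:R[%classic : set R.
pose U := \bigcup_(d in [set` J]) arc d.
have oU : open U by apply: bigcup_open => d _; exact: interval_open.
have U01 : U `<=` `[0, 1[.
  move=> x [d _]; rewrite /arc/= !in_itv/= => /andP[h1 h2].
  rewrite (le_trans _ (ltW h1))/=; last by rewrite divr_ge0.
  by rewrite (lt_le_trans h2)// ler_pdivrMr// mul1r ler_nat.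
exists (pi @` U); last first.
  apply: le_trans (circle_haar_image _ oU U01).
  rewrite lebesgue_measure_arcs//; last by move=> ? ? _ _; exact: enc_inj.
  rewrite lee_fin [(#|Z| * _)%:R]natrM invfM mulrA ler_pM2r ?invr_gt0//.
  rewrite ler_pdivrMr ?ltr0n ?(leq_ltn_trans _ (max_card (pred1 0)))//.
    rewrite -natrM ler_nat; apply: leq_trans cI.
    by rewrite card_ffun card_ord.
  by apply/card_gt0P; exists 0.
split; first exact: circle_borel_image_open.
exists (fun v => pi ((p v)%:R / N%:R)) => u v euv.
apply/seteqP; split => // a [[_ [x [d dJ xd] <-] <-] [_ [y [d' dJ' yd'] <-]]] /=.
rewrite -!circle_piD => /esym/eqP/circle_piP[n E].
have {E} E : x * N%:R + (p u)%:R = y * N%:R + (p v)%:R + n%:~R * N%:R :> R.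
  have -> : x = y + (p v)%:R / N%:R + n%:~R - (p u)%:R / N%:R by rewrite -E addrK.
  by field; rewrite gt_eqF.
move: xd yd'; rewrite /arc/= !in_itv/= !ltr_pdivrMr// !ltr_pdivlMr// -!natr1.
move=> /andP[x1 x2] /andP[y1 y2].
(* By [E], the integer [i] is the difference of the offsets of [y] and [x] within their arcs, in
   units of [1/N]. Both offsets lie strictly between 0 and 1, so [i = 0]. *)
pose i : int := (enc d + p u)%N%:Z - (enc d' + p v)%N%:Z - n * N.
have iE : i%:~R = (y * N%:R - (enc d')%:R) - (x * N%:R - (enc d)%:R) :> R.
  by rewrite /i !intrB intrM -!pmulrn !natrD; lra.
have : (i%:~R < 1%:~R :> R) && ((-1)%:~R < i%:~R :> R).
  by rewrite iE; apply/andP; split; lra.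
rewrite !ltr_int /i => /andP[i1 i2].
have := encDlt d u; have := encDlt d' v => l1 l2.
(* Both codes are below [N], so there is no winding around the circle. *)
have n0 : n = 0 by nia.
have Eab : (enc d + p u = enc d' + p v)%N by lia.
have {Eab} dd' : forall w, (d w + (w == u) = d' w + (w == v))%N.
  by apply: p_inj => [w|w|]; rewrite -?encD//; exact: digit.
have FE : F d + h u = F d' + h v.
  by rewrite /F -!sum_mulrn_incr; apply: eq_bigr => w _; rewrite dd'.
(* [F d] and [F d'] both lie in [I] but differ by [h v - h u], an element of [S]. *)
have := hP _ _ euv.
rewrite /cayley -(_ : F d - F d' = h v - h u).
  move: dJ dJ'; rewrite /= !inE => dI d'I.
  by move/independentP: iI => /(_ _ _ d'I dI) /negP; apply.
by apply/eqP; rewrite subr_eq addrAC -subr_eq opprK FE addrC.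
Qed.

Lemma box_cayley (M : nat) (A : set (circle R)) :
  symmetric e -> irreflexive e -> circle_borel A -> coloring_base e A ->
  exists (Z : finZmodType) (S : {set Z}),
    [/\ connection_set S, graph_hom e (cayley S), #|Z| = (M.+2 ^ k)%N &
     ((M.+1 ^ k)%:R%:E * circle_haar A <= (independence_number (cayley S))%:R%:E)%E].
Proof.
move=> e_sym e_irr bA [f fP].
pose Z : finZmodType := {ffun V -> 'I_M.+2}.
pose delta u : Z := [ffun v => inord (v == u)].
have deltaE u v : delta u v = (v == u) :> nat.
  by rewrite ffunE inordK//; case: (v == u).
pose S : {set Z} :=
  [set s | [exists u, exists v, e u v && (s == delta v - delta u)]]%SET.
have SP s : reflect (exists u v, e u v /\ s = delta v - delta u) (s \in S).
  rewrite inE; apply: (iffP existsP) => [[u /existsP[v]]|[u [v [euv ->]]]].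
    by move=> /andP[euv /eqP ->]; exists u, v.
  by exists u; apply/existsP; exists v; rewrite euv eqxx.
exists Z, S; split.
- split.
    have SN s : s \in S -> - s \in S.
      move=> /SP[u [v [euv ->]]]; apply/SP; exists v, u.
      by rewrite e_sym opprB.
    apply/setP => s; apply/idP/imsetP => [/SN Ss|[t /SN ? ->]//].
    by exists (- s) => //; rewrite opprK.
  apply/negP => /SP[u [v [euv /esym/eqP]]]; rewrite subr_eq0 => /eqP E.
  have := congr1 (fun z : Z => z v : nat) E; rewrite !deltaE eqxx.
  by case: eqP => // vu; move: euv; rewrite vu e_irr.
- exists delta => u v euv; rewrite /cayley; apply/SP; by exists u, v.
- by rewrite card_ffun card_ord.
pose t (d : {ffun V -> 'I_M.+1}) := \sum_v f v *+ d v.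
have -> : (M.+1 ^ k)%N = #|{ffun V -> 'I_M.+1}| by rewrite card_ffun card_ord.
apply: (circle_haar_average _ t) => // x.
set D := finset _.
(* The fibre [D] over [x] is carried injectively into the group [Z], where its independence is to be
   shown. *)
pose g (d : {ffun V -> 'I_M.+1}) : Z := [ffun v => inord (d v)].
have gE d v : g d v = d v :> nat.
  by rewrite ffunE inordK// ltnW// ltnS.
have g_inj : injective g.
  by move=> d d' E; apply/ffunP => v; apply/val_inj; rewrite -[LHS]gE E gE.
rewrite -(card_imset _ g_inj); apply: leq_independence_number.
apply/independentP => _ _ /imsetP[d dD ->] /imsetP[d' d'D ->].
rewrite /cayley; apply/negP => /SP[u [v [euv /eqP]]].
rewrite subr_eq addrAC eq_sym subr_eq => /eqP E.
(* Incremented digits stay below [M.+2], so the congruences modulo [M.+2] are equalities of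
   naturals. *)
have {E} E w : (d w + (w == v) = d' w + (w == u))%N.
  have := congr1 (fun z : Z => z w : nat) E.
  have dlt (d0 : {ffun V -> 'I_M.+1}) (b : bool) : (b + d0 w < M.+2)%N.
    by have := ltn_ord (d0 w); case: b; lia.
  rewrite !ffunE /= !inordK ?(dlt _ false)//; do 2?by case: (_ == _).
  by rewrite [in RHS]addnC ![(_ + nat_of_bool _)%N]addnC !modn_small.
have tE : t d + f v = t d' + f u.
  by rewrite /t -!sum_mulrn_incr; apply: eq_bigr => w _; rewrite E.
move: dD d'D; rewrite !inE => Ad Ad'.
(* This point equals [x + t d' + f u] as well, so it lies in both translates along an edge. *)
have : (translate A (f u) `&` translate A (f v)) (x + t d + f v).
  by split; [exists (x + t d') => //; rewrite -!addrA tE | exists (x + t d)].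
by rewrite fP.
Qed.

End Gyro.

(** * Density of coloring bases against independence ratios *)

Section Density.
Context {R : realType} {V : finType} {e : rel V}.
Local Notation k := #|V|.

Lemma circle_haar_ge0 (A : set (circle R)) : (0 <= circle_haar A)%E.
Proof. exact: measure_ge0. Qed.

Lemma set0_base : circle_borel (set0 : set (circle R)) /\
  coloring_base e (set0 : set (circle R)).
Proof.
split; first exact: sigma_algebra0.
by exists (fun=> 0) => u v _; rewrite /translate image_set0 set0I.
Qed.

Lemma gyro_density_itv : (0 <= gyro_density R e <= 1)%E.
Proof.
apply/andP; split.
  apply: le_ereal_sup_tmp; exists (circle_haar set0); last exact: circle_haar_ge0.
  by exists set0 => //; exact: set0_base.
by apply: ge_ereal_sup => _ [A [bA _] <-]; exact: circle_haar_le1.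
Qed.

Lemma independence_ratio_le_gyro_density {Z : finZmodType} {S : {set Z}} :
  0 \notin S -> graph_hom e (cayley S) ->
  (((independence_number (cayley S))%:R / #|Z|%:R)%:E <= gyro_density R e)%E.
Proof.
move=> S0 hom; have [] := andP gyro_density_itv.
case E : (gyro_density R e) => [r| |]//= _ _; rewrite lee_fin.
have Z0 : 0 < #|Z|%:R :> R by rewrite ltr0n; apply/card_gt0P; exists 0.
apply: (box_ratio_limit _ k); first by rewrite divr_ge0.
move=> M; have [A [bA cA]] := arcs_base (R := R) M S0 hom.
have hA : (circle_haar A <= r%:E)%E.
  by rewrite -E; apply: le_ereal_sup_tmp; exists (circle_haar A) => //; exists A.
move=> /le_trans/(_ hA); rewrite lee_fin !natrM !natrX.
rewrite ler_pdivrMr ?mulr_gt0 ?exprn_gt0// => h.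
by rewrite mulrAC ler_pdivrMr// -mulrA [_ * #|Z|%:R]mulrC.
Qed.

End Density.

Theorem corollary12 (R : realType) (V : finType) (e : rel V)
    (e_sym : symmetric e) (e_irr : irreflexive e) :
  gyrochromatic_number R e =
    ereal_inf [set x : \bar R | exists (Z : finZmodType) (S : {set Z}),
      [/\ connection_set S, graph_hom e (cayley S) &
        x = (fractional_chromatic_number R (cayley S))%:E]] /\
  gyrochromatic_number R e =
    ereal_inf [set x : \bar R | exists (Z : finZmodType) (S : {set Z}),
      [/\ connection_set S, graph_hom e (cayley S) &
        x = (#|{: Z}|%:R / (independence_number (cayley S))%:R)%:E]].
Proof.
set X := [set x | _]; set Y := [set x | _].
have -> : X = Y.
  by apply/seteqP; split => x -[Z [S [cS hS ->]]]; exists Z, S; split => //;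
    case: cS => _ S0; rewrite fractional_chromatic_cayley.
suff : gyrochromatic_number R e = ereal_inf Y by [].
rewrite /gyrochromatic_number.
have [] := andP (gyro_density_itv (R := R) (e := e)).
case E : (gyro_density R e) => [r| |]//; rewrite !lee_fin => r0 _.
apply/eqP; rewrite eq_le; apply/andP; split.
  apply: le_ereal_inf_tmp => _ [Z [S [[_ S0] hS ->]]].
  have a0 : 0 < (independence_number (cayley S))%:R :> R.
    by rewrite ltr0n independence_number_gt0.
  have Z0 : 0 < #|Z|%:R :> R by rewrite ltr0n; apply/card_gt0P; exists 0.
  have := independence_ratio_le_gyro_density (R := R) S0 hS; rewrite E lee_fin => ar.
  (* Positivity excludes the convention that the inverse of 0 is [+oo]. *)
  have r_gt0 : 0 < r by apply: lt_le_trans ar; rewrite divr_gt0.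
  by rewrite inver gt_eqF// lee_fin -[leRHS]invf_div lef_pV2// posrE divr_gt0.
have Y1 y : Y y -> (1 <= y)%E.
  move=> [Z [S [[_ S0] hS ->]]]; rewrite lee_fin ler_pdivlMr.
    rewrite mul1r ler_nat; have [I _ <-] := independence_number_attained (S := S).
    exact: max_card.
  by rewrite ltr0n independence_number_gt0.
have Ybox A M : circle_borel A -> coloring_base e A -> exists2 a : nat,
    Y ((M.+2 ^ #|V|)%N%:R / a%:R)%:E & (0 < a)%N /\
    ((M.+1 ^ #|V|)%:R%:E * circle_haar A <= (a%:R : R)%:E)%E.
  move=> bA cA; have [Z [S [cS hS cZ hA]]] := box_cayley M _ e_sym e_irr bA cA.
  exists (independence_number (cayley S)).
    by exists Z, S; split => //; rewrite cardT -cardE cZ.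
  by case: cS => _ S0; split => //; exact: independence_number_gt0.
(* The infimum is finite: all ratios are at least 1, and the box group obtained from the empty base
   supplies one. *)
have [s infY] : exists s, ereal_inf Y = s%:E.
  have [b0 c0] := set0_base (R := R) (e := e).
  have [a Ya _] := Ybox _ 0 b0 c0.
  have : (ereal_inf Y <= (((0.+2 ^ #|V|)%N%:R : R) / a%:R)%:E)%E.
    by apply: ge_ereal_inf; exists ((((0.+2 ^ #|V|)%N%:R : R) / a%:R)%:E).
  have : (1 <= ereal_inf Y)%E by exact: le_ereal_inf_tmp.
  by case: (ereal_inf Y) => [s| |]// _ _; exists s.
have s1 : 1 <= s by rewrite -lee_fin -infY; exact: le_ereal_inf_tmp.
have s0 : 0 < s := lt_le_trans ltr01 s1.
have rs : r <= s^-1.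
  rewrite -lee_fin -E; apply: ge_ereal_sup => _ [A [bA cA] <-].
  have := circle_haar_ge0 A; have := circle_haar_le1 A bA.
  case hA : (circle_haar A) => [q| |]//; rewrite !lee_fin => _ q0.
  (* For every [M], [q * M.+1 ^ #|V| <= a] while [s * a <= M.+2 ^ #|V|]; the limit gives
     [q <= 1/s]. *)
  apply: (box_ratio_limit _ #|V|) => // M.
  have [a Ya [a0]] := Ybox A M bA cA; rewrite hA -EFinM lee_fin => qa.
  have : (ereal_inf Y <= ((M.+2 ^ #|V|)%N%:R / a%:R)%:E)%E.
    by apply: ge_ereal_inf; exists ((M.+2 ^ #|V|)%N%:R / a%:R)%:E.
  rewrite infY lee_fin ler_pdivlMr ?ltr0n// -!natrX => sa.
  by rewrite mulrC (le_trans qa)// ler_pdivlMl.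
(* For [r = 0] the inverse is [+oo] and the bound is trivial. *)
rewrite infY inver; case: eqP => [_|/eqP r_neq0]; first exact: leey.
have r_gt0 : 0 < r by rewrite lt_def r_neq0.
by rewrite lee_fin -[leLHS]invrK lef_pV2// posrE invr_gt0.
Qed.
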